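(* Let $a,b,c\ge 2$ be integers. If either $b$ or $c$ equals $2$, then the iterated plethysm $s_c\circ s_b\circ s_a$ is flip-symmetric with offset $abc-2(bc-1)$.
   Context: Let $\Lambda=\mathbb{Q}[p_1,p_2,\dots]$ be the algebra of symmetric functions, with power sums $p_k$ and Schur functions $s_\lambda$; $s_n=s_{(n)}$. The plethysm $\circ$ is determined by: $p_n\circ p_m=p_{nm}$; for each $f\in\Lambda$ the map $g\mapsto g\circ f$ is an algebra homomorphism; and $p_n\circ f=f\circ p_n$ (so $p_n\circ f$ is obtained from $f$ by replacing each $p_m$ by $p_{nm}$). Plethysm is associative. A partition is a hook+column partition if it is of the form $(\alpha,2^\beta,1^\gamma)$, where $\alpha$ is the first part (possibly equal to $1$ or $2$), followed by $\beta$ parts equal to $2$ and $\gamma$ parts equal to $1$. Flip involution: let $r\ge 2$ be an integer and $\lambda=(\lambda_1,2^\beta,1^\gamma)$ a hook+column partition such that $\lambda_1-r-\gamma=2\delta$ for some non-negative integer $\delta$. Then the flip with offset $r$ is defined on $\lambda=(r+2\delta+\gamma,2^\beta,1^\gamma)$ by $\mathrm{flip}(r;\lambda)=(r+2\beta+\gamma,2^\delta,1^\gamma)$. It is not defined on other partitions. Write $[\mu]f$ for the coefficient of $s_\mu$ in the Schur expansion of $f$, and $\mathrm{supp}(f)=\{\mu:[\mu]f\neq 0\}$. A symmetric function $f$ is flip-symmetric with offset $r$ if for every hook+column partition $\mu\in\mathrm{supp}(f)$: (1) $\mathrm{flip}(r;-)$ is defined on $\mu$, and (2) $[\mu]f=[\mathrm{flip}(r;\mu)]f$.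 *)

(* Defs.v *)
From HB Require Import structures.
From mathcomp Require Import all_boot all_order all_algebra.
From mathcomp Require Import finmap.
From mathcomp.multinomials Require Import monalg.

Set Implicit Arguments.
Unset Strict Implicit.
Unset Printing Implicit Defensive.

Import GRing.Theory Num.Theory.
Local Open Scope ring_scope.

(* Polynomials over rat in countably many variables; the variable of index i
   is the power sum p_(i+1). *)
Notation symfun := {malg rat[{cmonom nat}]}.

(* p_k for k >= 1; the value at k = 0 is junk. *)
Definition psum (k : nat) : symfun := << ucm k.-1 >>.

Definition monom_eval (A : comAlgType rat) (v : nat -> A) (m : {cmonom nat}) : A :=
  \prod_(i <- finsupp m) v i.+1 ^+ m i.

(* The algebra morphism sending p_k to v k for every k >= 1. *)
Definition psum_eval (A : comAlgType rat) (v : nat -> A) (f : symfun) : A :=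
  mmap (in_alg A) (monom_eval v) f.

Section PsumEval.
Context (A : comAlgType rat) (v : nat -> A).

Lemma monom_evalEw (d : {fset nat}) (m : {cmonom nat}) :
  (finsupp m `<=` d)%fset -> monom_eval v m = \prod_(i <- d) v i.+1 ^+ m i.
Proof.
move=> le; rewrite /monom_eval; apply: (big_fset_incl _ le) => i _.
by rewrite -cmE_eq0 => /eqP ->.
Qed.

Lemma monom_eval_is_mmorphism : mmorphism (monom_eval v).
Proof.
split=> [m1 m2|]; last by rewrite /monom_eval mdom1 big_seq_fset0.
rewrite (monom_evalEw (d := (finsupp m1 `|` finsupp m2)%fset)) ?mdomD //.
rewrite (monom_evalEw (fsubsetUl _ (finsupp m2))).
rewrite (monom_evalEw (fsubsetUr (finsupp m1) _)) -big_split /=.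
by apply: eq_bigr => i _; rewrite cmM exprD.
Qed.

HB.instance Definition _ :=
  isMultiplicative.Build _ _ (monom_eval v) monom_eval_is_mmorphism.

HB.instance Definition _ := GRing.RMorphism.copy (psum_eval v)
  (mmap (in_alg A) (monom_eval v)).

Lemma psum_evalZ (c : rat) (f : symfun) :
  psum_eval v (c *: f) = c *: psum_eval v f.
Proof. by rewrite /psum_eval mmapZ /= mulr_algl. Qed.

HB.instance Definition _ :=
  GRing.isScalable.Build rat symfun A *:%R (psum_eval v) psum_evalZ.

Lemma psum_eval_psum (k : nat) : (0 < k)%N -> psum_eval v (psum k) = v k.
Proof.
case: k => // k _; rewrite /psum_eval mmapU /= scale1r mul1r /monom_eval.
by rewrite mdomU big_seq_fset1 cmUU expr1.
Qed.
End PsumEval.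

Lemma eq_psum_eval (A : comAlgType rat) (v w : nat -> A) (f : symfun) :
  (forall k, (0 < k)%N -> v k = w k) -> psum_eval v f = psum_eval w f.
Proof.
move=> eqvw; rewrite /psum_eval !mmapE; apply: eq_bigr => m _.
by congr (_ * _); apply: eq_bigr => i _; rewrite eqvw.
Qed.

(* adams n f = p_n \circ f. *)
Definition adams (n : nat) (f : symfun) : symfun :=
  psum_eval (fun m => psum (n * m)) f.

(* pleth g f = g \circ f. *)
Definition pleth (g f : symfun) : symfun :=
  psum_eval (fun n => adams n f) g.

(* The three properties characterizing plethysm; that g |-> pleth g f is an
   algebra morphism is the instance on psum_eval above. *)
Lemma pleth_psum (n m : nat) : (0 < n)%N -> (0 < m)%N ->
  pleth (psum n) (psum m) = psum (n * m).
Proof. by move=> n0 m0; rewrite /pleth psum_eval_psum // /adams psum_eval_psum. Qed.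

Lemma pleth_psuml (n : nat) (f : symfun) : (0 < n)%N ->
  pleth (psum n) f = adams n f.
Proof. exact: psum_eval_psum. Qed.

Lemma pleth_psumr (n : nat) (f : symfun) : (0 < n)%N ->
  pleth (psum n) f = pleth f (psum n).
Proof.
move=> n0; rewrite (pleth_psuml _ n0); apply: eq_psum_eval => k k0.
by rewrite /adams (psum_eval_psum _ n0) mulnC.
Qed.

(* hcomp_rev n = [:: h_n; ...; h_1; h_0], with h_n given by Newton's identity
   n h_n = \sum_(1 <= k <= n) p_k h_(n-k). *)
Fixpoint hcomp_rev (n : nat) : seq symfun :=
  if n is n'.+1 then
    let s := hcomp_rev n' in
    (n%:R^-1 *: \sum_(i < n) psum i.+1 * s`_i) :: s
  else [:: 1].

(* The complete homogeneous symmetric function h_n. *)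
Definition hcomp (n : nat) : symfun := (hcomp_rev n)`_0.

Lemma hcomp0 : hcomp 0 = 1.
Proof. by []. Qed.

Lemma hcomp_newton (n : nat) :
  n%:R *: hcomp n = \sum_(i < n) psum i.+1 * hcomp (n - i.+1).
Proof.
have nthE m i : (i <= m)%N -> (hcomp_rev m)`_i = hcomp (m - i).
  elim: m i => [|m IHm] [|i] //= lei; exact: IHm.
case: n => [|n]; first by rewrite scale0r big_ord0.
have -> : hcomp n.+1 =
    n.+1%:R^-1 *: \sum_(i < n.+1) psum i.+1 * (hcomp_rev n)`_i by [].
have n0 : n.+1%:R != 0 :> rat by rewrite pnatr_eq0.
rewrite scalerA (divff n0) scale1r; apply: eq_bigr => i _.
have lei : (i <= n)%N by rewrite -ltnS.
by rewrite subSS (nthE _ _ lei).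
Qed.

Definition is_intpart (s : seq nat) : bool := sorted geq s && (0%N \notin s).

Record intpart : Type := IntPart { parts :> seq nat; _ : is_intpart parts }.
HB.instance Definition _ := [isSub for parts].
HB.instance Definition _ := [Choice of intpart by <:].

(* The Schur function s_l, by the Jacobi-Trudi determinant
   det (h_(l_i - i + j)), with h_k = 0 for k < 0. *)
Definition schur (l : seq nat) : symfun :=
  \det (\matrix_(i < size l, j < size l)
          if (i <= nth 0%N l i + j)%N then hcomp (nth 0%N l i + j - i) else 0).

Notation schur_row n := (schur [:: n]).

Lemma schur_row_hcomp (n : nat) : schur_row n = hcomp n.
Proof. by rewrite /schur det_mx11 mxE /= addn0 subn0. Qed.

(* c is the Schur expansion of f: c@_mu is the coefficient of s_mu in f, and
   msupp c is the support of f.  As the Schur functions form a basis, f has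
   exactly one such c. *)
Definition schur_expansion (f : symfun) (c : {malg rat[intpart]}) : Prop :=
  f = \sum_(l <- msupp c) c@_l *: schur l.

(* The sequence (alpha, 2^beta, 1^gamma). *)
Definition hook_column_seq (alpha beta gamma : nat) : seq nat :=
  alpha :: nseq beta 2%N ++ nseq gamma 1%N.

Definition hook_column (l : intpart) : Prop :=
  exists alpha beta gamma : nat, l = hook_column_seq alpha beta gamma :> seq nat.

(* flip_to r l m: flip(r; l) is defined and equal to m. *)
Definition flip_to (r : nat) (l m : intpart) : Prop :=
  (2 <= r)%N /\
  exists beta gamma delta : nat,
    l = hook_column_seq (r + 2 * delta + gamma) beta gamma :> seq nat /\
    m = hook_column_seq (r + 2 * beta + gamma) delta gamma :> seq nat.

Definition flip_symmetric (r : nat) (f : symfun) : Prop :=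
  exists2 c : {malg rat[intpart]}, schur_expansion f c &
    forall mu : intpart, hook_column mu -> mu \in msupp c ->
      exists2 nu : intpart, flip_to r mu nu & c@_mu = c@_nu.

(* Main.v *)
Require Import Defs.
From mathcomp Require Import all_boot all_order all_algebra.
From mathcomp Require Import all_fingroup finmap.
From mathcomp.multinomials Require Import monalg.
From mathcomp Require Import zify ring.

(** Evaluate symmetric functions at the virtual alphabet x - y - z, that is,
    p_k |-> x^k - y^k - z^k.  Up to the signs of y and z this is the character of
    gl(1|2), so s_l vanishes unless l fits in one row and two columns, that is,
    unless l is a hook+column partition, and for l = (i+2, 2^b, 1^c)
      (y - z) s_l = x^i (x - y) (x - z) (y z)^b (-1)^c (y^(c+1) - z^(c+1))
    (jacobi_trudi_hook_column, jacobi_trudi_third_column).  Hence this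
    evaluation sees exactly the coefficients concerned, and separates them.

    For n >= 2 the value of h_n is x^(n-2) (x - y) (x - z).  With
    x = u q, y = q^2, z = 1 the factor E = (x - y) (x - z) equals
    q (u - q) (u q - 1), and it does not change when one takes x = q, y = u q^2,
    z = u instead.  As the same holds for the Adams operations of E, the
    evaluation of any f o h_a with f homogeneous of degree d is
    x^(d (a-2)) times a quantity invariant under this exchange
    (pleth3_eval_swap).  The exchange turns the power of u in the value of s_l
    from i into 2 b + c (hook_column_swap), so that, after the comparison of the
    powers of x, it is the flip; comparing coefficients of the monomials in u
    and q gives the theorem, including the existence of the flipped partition
    (flip_coef).  A single column (1^n) is not covered by the formula; the
    alphabet reduced to -1 detects it and kills h_a for a >= 2
    (schur_schur_column_absent).

    The Schur expansion itself exists because the Jacobi-Trudi matrix expands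
    s_l as h_l plus products h_m with m of strictly larger sum of squares, so that
    products of complete functions are combinations of Schur functions of the
    same degree (hprod_span). *)

Set Implicit Arguments.
Unset Strict Implicit.
Unset Printing Implicit Defensive.

Import Order.TTheory GRing.Theory Num.Theory.
Local Open Scope ring_scope.

(** * Evaluations of complete functions and of plethysms *)

Lemma psum_eval_comp (A : comAlgType rat) (w : nat -> A) (v : nat -> symfun) f :
  psum_eval w (psum_eval v f) = psum_eval (fun k => psum_eval w (v k)) f.
Proof.
rewrite {2 3}/psum_eval !mmapE rmorph_sum /=; apply: eq_bigr => m _.
rewrite /= !mulr_algl psum_evalZ; congr (_ *: _).
by rewrite rmorph_prod; apply: eq_bigr => i _; rewrite rmorphXn.
Qed.

Lemma psum_eval_pleth (A : comAlgType rat) (v : nat -> A) (g f : symfun) :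
  psum_eval v (pleth g f)
  = psum_eval (fun n => psum_eval (fun m => v (n * m)%N) f) g.
Proof.
rewrite psum_eval_comp; apply: eq_psum_eval => n n0.
rewrite psum_eval_comp; apply: eq_psum_eval => m m0.
by rewrite psum_eval_psum // muln_gt0 n0.
Qed.

(** The sequence h stands for the complete functions of the alphabet whose power
    sums are v; Newton's identities determine it. *)
Definition newton (A : comAlgType rat) (v h : nat -> A) : Prop :=
  h 0%N = 1 /\ forall n, n%:R *: h n = \sum_(i < n) v i.+1 * h (n - i.+1)%N.

Lemma newton_psum_eval (A : comAlgType rat) (v : nat -> A) :
  newton v (fun n => psum_eval v (hcomp n)).
Proof.
split=> [|n]; first by rewrite hcomp0 rmorph1.
rewrite -linearZ hcomp_newton rmorph_sum; apply: eq_bigr => i _.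
by rewrite rmorphM /= psum_eval_psum.
Qed.

(** In the recursion of Newton's identities, h_(n+1) depends on all h_m with
    m <= n. *)
Lemma newton_ind (P : nat -> Prop) :
  P 0%N -> (forall n, (forall m, (m <= n)%N -> P m) -> P n.+1) -> forall n, P n.
Proof.
move=> P0 PS n; elim/ltn_ind: n => -[|n] IHn //.
by apply: PS => m lemn; apply: IHn.
Qed.

Lemma newton_uniq (A : comAlgType rat) (v h g : nat -> A) :
  newton v h -> newton v g -> h =1 g.
Proof.
move=> [h0 hS] [g0 gS]; apply: newton_ind => [|n IHn]; first by rewrite h0 g0.
have n0 : n.+1%:R != 0 :> rat by rewrite pnatr_eq0.
apply: (can_inj (scalerK n0)); rewrite hS gS; apply: eq_bigr => i _.
by rewrite subSS IHn // leq_subr.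
Qed.

Lemma newton_hcomp (A : comAlgType rat) (v h : nat -> A) n :
  newton v h -> psum_eval v (hcomp n) = h n.
Proof. by move=> N; rewrite -(newton_uniq (newton_psum_eval v) N). Qed.

Lemma hcomp_scale (A : comAlgType rat) (u : A) (v : nat -> A) n :
  psum_eval (fun k => u ^+ k * v k) (hcomp n) = u ^+ n * psum_eval v (hcomp n).
Proof.
apply: (newton_hcomp (h := fun n => u ^+ n * psum_eval v (hcomp n))).
have [h0 hS] := newton_psum_eval v; split=> [|m]; first by rewrite h0 mul1r.
rewrite scalerAr hS mulr_sumr; apply: eq_bigr => i _.
by rewrite -{1}(subnKC (ltn_ord i)) exprD; ring.
Qed.

Lemma newton_geometric (A : comAlgType rat) (x : A) :
  newton (fun k => x ^+ k) (fun n => x ^+ n).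
Proof.
split=> // n; under eq_bigr => i _ do rewrite -exprD subnKC //.
by rewrite sumr_const card_ord scaler_nat.
Qed.

(** Removing the letter y from an alphabet multiplies the generating series of
    the complete functions by 1 - y s. *)
Definition drop_var (A : nzRingType) (y : A) (h : nat -> A) (n : nat) : A :=
  if n is m.+1 then h n - y * h m else h 0%N.

(** The sum telescopes. *)
Lemma drop_var_sum (A : comAlgType rat) (y : A) (h : nat -> A) n :
  \sum_(i < n) y ^+ i.+1 * drop_var y h (n - i.+1)%N = y * (if n is m.+1 then h m else 0).
Proof.
elim: n => [|n IHn]; first by rewrite big_ord0 mulr0.
rewrite big_ord_recl /= subSS subn0 expr1.
under eq_bigr => i _ do rewrite /bump /= add1n subSS exprS -mulrA.
rewrite -mulr_sumr IHn -mulrDr; congr (_ * _).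
by case: n {IHn} => [|n] /=; rewrite ?mulr0 ?addr0 ?subrK.
Qed.

Lemma newton_drop_var (A : comAlgType rat) (y : A) (v h : nat -> A) :
  newton v h -> newton (fun k => v k - y ^+ k) (drop_var y h).
Proof.
move=> [h0 hS]; split=> // n; under eq_bigr => i _ do rewrite mulrBl.
rewrite sumrB drop_var_sum; case: n => [|n]; first by rewrite big_ord0 mulr0 subr0 scale0r.
have -> : \sum_(i < n.+1) v i.+1 * drop_var y h (n.+1 - i.+1)%N =
    n.+1%:R *: h n.+1 - y * (n%:R *: h n).
  rewrite !hS [in LHS]big_ord_recr [in RHS]big_ord_recr /= subnn /=.
  rewrite mulr_sumr addrAC; congr (_ + _).
  rewrite -sumrB; apply: eq_bigr => i _.
  rewrite subSS (_ : (n - i = (n - i.+1).+1)%N) /=; first by ring.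
  by rewrite subnSK.
rewrite /= scalerBr -addrA; congr (_ + _).
by rewrite -[n.+1]addn1 natrD scalerDl scale1r -scalerAr opprD.
Qed.

(** Power sums and complete functions of the virtual alphabet x - y - z. *)
Definition hook_psum (A : comAlgType rat) (x y z : A) (k : nat) : A :=
  x ^+ k - y ^+ k - z ^+ k.

Definition hook_hcomp (A : comAlgType rat) (x y z : A) (n : nat) : A :=
  match n with
  | 0 => 1
  | 1 => x - y - z
  | n.+2 => x ^+ n * ((x - y) * (x - z))
  end.

Lemma hook_psum_hcomp (A : comAlgType rat) (x y z : A) n :
  psum_eval (hook_psum x y z) (hcomp n) = hook_hcomp x y z n.
Proof.
have N := newton_drop_var z (newton_drop_var y (newton_geometric x)).
rewrite (newton_hcomp n N); case: n => [|[|n]] //=; first by rewrite !expr1 !expr0 !mulr1.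
by case: n => [|n] /=; rewrite ?expr0 ?expr1 ?exprS; ring.
Qed.

(** * Jacobi-Trudi determinants of hook shape *)

(** The value of h at n - i in Z, for a sequence h extended by 0 to the negative
    integers. *)
Definition shifted (A : nzRingType) (h : nat -> A) (n i : nat) : A :=
  if (i <= n)%N then h (n - i)%N else 0.

Definition jacobi_trudi (A : comNzRingType) (h : nat -> A) (l : seq nat) : A :=
  \det (\matrix_(i < size l, j < size l) shifted h (nth 0%N l i + j) i).

Lemma psum_eval_schur (A : comAlgType rat) (v h : nat -> A) (l : seq nat) :
  (forall n, psum_eval v (hcomp n) = h n) ->
  psum_eval v (schur l) = jacobi_trudi h l.
Proof.
move=> vE; rewrite /schur -det_map_mx; congr (\det _); apply/matrixP=> i j.
by rewrite !mxE /shifted; case: ifP => _; rewrite ?rmorph0 //= vE.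
Qed.

Lemma eq_jacobi_trudi (A : comNzRingType) (h g : nat -> A) l :
  h =1 g -> jacobi_trudi h l = jacobi_trudi g l.
Proof.
move=> e; congr (\det _); apply/matrixP=> i j; rewrite !mxE /shifted.
by case: ifP => // _; rewrite e.
Qed.

Lemma det_row_single (A : comNzRingType) n (M : 'M[A]_n.+1) :
  (forall j : 'I_n, M 0 (lift 0 j) = 0) ->
  \det M = M 0 0 * \det (row' 0 (col' 0 M)).
Proof.
move=> M0; rewrite (expand_det_row _ 0) big_ord_recl big1 ?addr0 => [|j _].
  by rewrite /cofactor expr0 mul1r.
by rewrite M0 mul0r.
Qed.

(** Subtracting from each column x times the preceding one is a product with a
    unitriangular matrix. *)
Lemma det_drop_cols (A : comNzRingType) n (x : A) (M : 'M[A]_n) (f : nat -> nat -> A) :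
  (forall i j, M i j = f i j) ->
  \det M = \det (\matrix_(i < n, j < n)
     (if (j : nat) is k.+1 then f i j - x * f i k else f i 0%N)).
Proof.
case: n M => [|n] M Mf; first by rewrite !det_mx00.
pose U : 'M[A]_n.+1 := \matrix_(k, j)
  ((k == j)%:R - (if k.+1 == j then x else 0)).
have detU : \det U = 1.
  rewrite -det_tr det_trig; last first.
    apply/is_trig_mxP => i j ij; rewrite !mxE.
    by rewrite -val_eqE /= gtn_eqF // gtn_eqF ?subrr // ltnW.
  by apply: big1 => i _; rewrite !mxE eqxx gtn_eqF ?subr0.
rewrite -[LHS]mulr1 -detU -det_mulmx; congr (\det _); apply/matrixP => i j.
rewrite !mxE; under eq_bigr => k _ do rewrite mxE mulrBr.
rewrite sumrB (bigD1 j) //= eqxx mulr1 big1 ?addr0 => [|k /negPf->]; last by rewrite mulr0.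
case: j => -[|j] ltj /=; rewrite Mf; first by rewrite big1 ?subr0 // => k _; rewrite mulr0.
rewrite (bigD1 (Ordinal (ltnW ltj))) //= eqxx Mf big1 ?addr0 1?mulrC // => k.
by rewrite -val_eqE /= eqSS => /negPf->; rewrite mulr0.
Qed.

(** When the first row is geometric of ratio x, subtracting x times the preceding
    column leaves a single entry in it, and turns h into drop_var x h in the other
    rows; the remaining minor is again a Jacobi-Trudi matrix. *)
Lemma jacobi_trudi_strip (A : comNzRingType) (x c : A) (h : nat -> A) a l :
  (forall j, h (a + j)%N = c * x ^+ j) ->
  jacobi_trudi h (a :: l) = c * jacobi_trudi (drop_var x h) l.
Proof.
move=> ha; rewrite /jacobi_trudi.
rewrite (@det_drop_cols _ _ x _ (fun i j => shifted h (nth 0%N (a :: l) i + j) i)); last first.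
  by move=> i j; rewrite mxE.
rewrite det_row_single => [|j]; rewrite !mxE /= /shifted /=; last first.
  by rewrite !subn0 !ha exprS mulrCA subrr.
rewrite subn0 ha expr0 mulr1; congr (_ * \det _); apply/matrixP => i j.
rewrite !mxE /= /bump /= !add1n addnS /shifted ltnS subSS !add0n.
set m := (_ + _)%N; case: ltngtP => [im|mi|->]; rewrite ?subrr ?mulr0 ?subr0 ?subnn //=.
by rewrite -(subnSK im).
Qed.

(** The first two rows are proportional. *)
Lemma jacobi_trudi_proportional (A : comNzRingType) (x c d : A) (h : nat -> A) a b l :
  (forall j, h (a + j)%N = c * x ^+ j) ->
  (forall j, h (b + j)%N = d * x ^+ j) ->
  jacobi_trudi h [:: a, b.+1 & l] = 0.
Proof.
move=> ha hb; rewrite (jacobi_trudi_strip _ ha).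
rewrite (@jacobi_trudi_strip _ 0 0) ?mul0r ?mulr0 // => j.
by rewrite mul0r addSn /= -addnS !hb exprS mulrCA subrr.
Qed.

(** The first column of the determinant is (h_a, 1, 0, ..., 0); the resulting
    expansion is Pieri's rule for the product of h_a with a column. *)
Lemma jacobi_trudi_hook (A : comNzRingType) (h : nat -> A) a m :
  h 0%N = 1 ->
  jacobi_trudi h (a :: nseq m.+1 1%N)
  = h a * jacobi_trudi h (nseq m.+1 1%N) - jacobi_trudi h (a.+1 :: nseq m 1%N).
Proof.
move=> h0; rewrite {1}/jacobi_trudi (expand_det_col _ 0) !big_ord_recl big1; last first.
  move=> i _; rewrite !mxE /= /shifted /bump /= !add1n addn0.
  by rewrite add0n nth_nseq; case: (i < m)%N; rewrite mul0r.
rewrite addr0 !mxE /= /cofactor expr0 expr1 /shifted /= !addn0 subn0 subnn h0 !mul1r mulN1r.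
congr (_ * _ - _); congr (\det _); apply/matrixP => i j; rewrite !mxE /=.
  by rewrite /bump /= !add1n addnS ltnS subSS.
case: i => -[|i] lti; rewrite /bump /= ?add1n ?add0n; first by rewrite addnS.
by rewrite addnS ltnS subSS.
Qed.

(** In this section E is the sequence of complete functions of -y-z: it is
    1, -(y+z), y z, 0, 0, ... *)
Section HookShape.
Variables (A : comAlgType rat) (x y z : A).
Let H := hook_hcomp x y z.
Let E := drop_var x H.

Let E1 : E 1%N = - (y + z). Proof. by rewrite /E /=; ring. Qed.
Let E2 j : E j.+2 = y * z * 0 ^+ j.
Proof. by case: j => [|j]; rewrite /E /= ?exprS; ring. Qed.

Let H2 a j : H (a.+2 + j)%N = x ^+ a * ((x - y) * (x - z)) * x ^+ j.
Proof. by rewrite !addSn /= exprD mulrAC. Qed.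

Lemma drop_var0 : drop_var 0 E =1 E.
Proof. by case=> // n; rewrite /= mul0r subr0. Qed.

(** With E as complete functions, the column is (-1)^n h_n(y, z): both sides
    satisfy the recurrence d_(n+2) = E_1 d_(n+1) - E_2 d_n. *)
Lemma jacobi_trudi_column n :
  (y - z) * jacobi_trudi E (nseq n 1%N) = (-1) ^+ n * (y ^+ n.+1 - z ^+ n.+1).
Proof.
elim/ltn_ind: n => -[|[|n]] IHn.
- by rewrite [jacobi_trudi _ _]det_mx00; ring.
- by rewrite [jacobi_trudi _ _]det_mx11 mxE /shifted /= /H /=; ring.
rewrite [nseq n.+2 _]/= (@jacobi_trudi_hook _ E 1%N n) //.
rewrite (@jacobi_trudi_strip _ 0 (y * z)) => [|j]; last by rewrite !addSn E2.
rewrite (eq_jacobi_trudi _ drop_var0) mulrBr mulrCA IHn // [in X in _ - X]mulrCA IHn //.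
by rewrite E1 !exprS; ring.
Qed.

Lemma jacobi_trudi_two_columns b c :
  jacobi_trudi E (nseq b 2%N ++ nseq c 1%N)
  = (y * z) ^+ b * jacobi_trudi E (nseq c 1%N).
Proof.
elim: b => [|b IHb]; first by rewrite mul1r.
rewrite /= (@jacobi_trudi_strip _ 0 (y * z)) => [|j]; last by rewrite !addSn E2.
by rewrite (eq_jacobi_trudi _ drop_var0) IHb exprS mulrA.
Qed.

(** The first row is geometric of ratio x because the part a + 2 is at least 2;
    stripping it leaves the columns in the alphabet -y-z. *)
Lemma jacobi_trudi_hook_column a b c :
  (y - z) * jacobi_trudi H (hook_column_seq a.+2 b c)
  = x ^+ a * ((x - y) * (x - z)) * (y * z) ^+ b
    * ((-1) ^+ c * (y ^+ c.+1 - z ^+ c.+1)).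
Proof.
rewrite (jacobi_trudi_strip _ (H2 a)) -/E jacobi_trudi_two_columns.
by rewrite -jacobi_trudi_column; ring.
Qed.

Lemma jacobi_trudi_third_column a b l :
  jacobi_trudi H [:: a.+2, b.+3 & l] = 0.
Proof. exact: jacobi_trudi_proportional (H2 a) (H2 b). Qed.

End HookShape.

(** In the alphabet -1 the only nonzero complete functions are h_0 = 1 and
    h_1 = -1. *)
Lemma jacobi_trudi_sign_column (A : comAlgType rat) n :
  jacobi_trudi (hook_hcomp (0 : A) 1 0) (nseq n 1%N) = (-1) ^+ n.
Proof.
elim: n => [|n IHn]; first exact: det_mx00.
rewrite /= (@jacobi_trudi_strip _ 0 (-1)) => [|j].
  rewrite exprS -IHn; congr (_ * _); apply: eq_jacobi_trudi.
  by case=> // m; rewrite /= mul0r subr0.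
by case: j => [|j]; rewrite add1n /= ?exprS; ring.
Qed.

(** * Existence of Schur expansions *)

(* Otherwise unification unfolds the recursion that defines hcomp. *)
Local Opaque hcomp psum.

Definition schur_comb (c : {malg rat[intpart]}) : symfun :=
  mmap (in_alg symfun) (fun l : intpart => schur l) c.

Lemma schur_combE c f : f = schur_comb c -> schur_expansion f c.
Proof.
by move=> ->; apply: eq_bigr => l _; rewrite -mulr_algl.
Qed.

Lemma schur_combD c d : schur_comb (c + d) = schur_comb c + schur_comb d.
Proof. exact: mmapD. Qed.

Lemma schur_combZ k c : schur_comb (k *: c) = k *: schur_comb c.
Proof.
rewrite /schur_comb (mmapEw (msuppZ_le _ _)) mmapE scaler_sumr /=.
by apply: eq_bigr => l _; rewrite mcoeffZ scalerAl scalerA.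
Qed.

(** The degree is recorded because the alphabets used below set one of three
    homogeneous variables to 1, and so separate only partitions of equal size. *)
Definition schur_span (n : nat) (f : symfun) : Prop :=
  exists2 c, f = schur_comb c & forall l : intpart, l \in msupp c -> sumn l = n.

Lemma schur_spanD n f g : schur_span n f -> schur_span n g -> schur_span n (f + g).
Proof.
move=> [c -> cn] [d -> dn]; exists (c + d); first by rewrite schur_combD.
by move=> l /(fsubsetP (msuppD_le _ _)); rewrite in_fsetU => /orP[/cn|/dn].
Qed.

Lemma schur_spanZ n k f : schur_span n f -> schur_span n (k *: f).
Proof.
move=> [c -> cn]; exists (k *: c); first by rewrite schur_combZ.
by move=> l /(fsubsetP (msuppZ_le _ _)) /cn.
Qed.

Lemma schur_span0 n : schur_span n 0.
Proof. by exists 0 => [|l]; rewrite ?msupp0 // /schur_comb mmap0. Qed.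

Lemma schur_span_sum n (I : Type) (r : seq I) (P : pred I) (F : I -> symfun) :
  (forall i, P i -> schur_span n (F i)) -> schur_span n (\sum_(i <- r | P i) F i).
Proof.
by move=> FP; elim/big_rec: _ => [|i f Pi]; [exact: schur_span0 | apply/schur_spanD/FP].
Qed.

Lemma schur_span_schur (l : intpart) : schur_span (sumn l) (schur l).
Proof.
exists << l >>; first by rewrite /schur_comb mmapU -[RHS]/(1%:A * _) scale1r mul1r.
by move=> m /(fsubsetP msuppU_le); rewrite in_fset1 => /eqP ->.
Qed.

Definition hprod (s : seq nat) : symfun := \prod_(i <- s) hcomp i.
Definition sqsum (s : seq nat) : nat := \sum_(i <- s) i ^ 2.

Lemma sqsum_le s : (sqsum s <= sumn s ^ 2)%N.
Proof.
rewrite /sqsum; elim: s => [|a s IHs]; rewrite ?big_nil // big_cons /=; nia.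
Qed.

Definition to_part (s : seq nat) : seq nat := sort geq [seq i <- s | i != 0%N].

Lemma to_partP s : is_intpart (to_part s).
Proof.
rewrite /is_intpart sort_sorted => [|i j]; last exact: leq_total.
by rewrite mem_sort mem_filter.
Qed.

Lemma big_to_part (R : Type) (idx : R) (op : Monoid.com_law idx) (F : nat -> R) s :
  F 0%N = idx -> \big[op/idx]_(i <- to_part s) F i = \big[op/idx]_(i <- s) F i.
Proof.
move=> F0; rewrite (perm_big _ (permEl (perm_sort _ _))) big_filter big_mkcond.
by apply: eq_bigr => -[|i] _ //=; rewrite F0.
Qed.

(** The values of s on {0, ..., m-1} are distinct, hence have at least the sum of
    the m smallest values. *)
Lemma perm_prefix_ge0 n (s : 'S_n) m :
  0 <= \sum_(i < n) ((i < m)%N%:R * ((s i)%:Z - i%:Z)).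
Proof.
have -> : \sum_(i < n) ((i < m)%N%:R * ((s i)%:Z - i%:Z)) =
   \sum_(i < n) (((i < m)%N%:R - (s i < m)%N%:R) * ((s i)%:Z - m%:Z)).
  (* Summing [i < m] (i - m) over i or over s i gives the same result; subtracting
     it makes every term nonnegative. *)
  under [RHS]eq_bigr => i _ do rewrite mulrBl; rewrite sumrB.
  rewrite -(reindex_inj (@perm_inj _ s) (P := xpredT) (F := fun i : 'I_n => (i < m)%N%:R * (i%:Z - m%:Z))).
  by rewrite -sumrB; apply: eq_bigr => i _; ring.
apply: sumr_ge0 => i _; case: (ltnP i m); case: (ltnP (s i) m) => /=; lia.
Qed.

Lemma geq_trans : transitive geq.
Proof. by move=> i j k /[swap]; exact: leq_trans. Qed.

(** Rearrangement inequality: by summation by parts, a nonincreasing l is a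
    nonnegative combination of indicators of initial segments, to which
    perm_prefix_ge0 applies. *)
Lemma rearrangement_ge0 (l : seq nat) (s : 'S_(size l)) : sorted geq l ->
  0 <= \sum_(i < size l) (nth 0%N l i)%:Z * ((s i)%:Z - i%:Z).
Proof.
move=> lS; pose d k : int := (nth 0%N l k)%:Z - (nth 0%N l k.+1)%:Z.
have d0 k : 0 <= d k.
  rewrite subr_ge0 lez_nat; have [lt|le] := ltnP k.+1 (size l); last by rewrite nth_default.
  by apply: (sorted_leq_nth geq_trans leqnn 0%N lS); rewrite ?inE // ltnW.
have lE (i : 'I_(size l)) : (nth 0%N l i)%:Z = \sum_(k < size l) (i < k.+1)%N%:R * d k.
  transitivity (\sum_(i <= k < size l) d k).
    have dE k : (i <= k < size l)%N -> d k = - (nth 0%N l k.+1)%:Z - - (nth 0%N l k)%:Z.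
      by rewrite opprK addrC.
    rewrite (telescope_sumr_eq (fun k => - (nth 0%N l k)%:Z) d (ltnW (ltn_ord i)) dE).
    by rewrite (nth_default _ (leqnn _)) oppr0 sub0r opprK.
  rewrite (big_nat_widenl _ 0%N) // big_mkord big_mkcond; apply: eq_bigr => k _.
  by rewrite ltnS; case: leqP; rewrite ?mul1r ?mul0r.
under eq_bigr => i _ do rewrite lE mulr_suml.
rewrite exchange_big; apply: sumr_ge0 => k _.
under eq_bigr => i _ do rewrite mulrAC mulrC; rewrite -mulr_sumr mulr_ge0 //.
exact: perm_prefix_ge0.
Qed.

(** The indices of the complete functions in the term of s in the expansion of the
    Jacobi-Trudi determinant. *)
Definition displace (l : seq nat) (s : 'S_(size l)) : seq nat :=
  map (fun i : 'I_(size l) => (nth 0 l i + s i - i)%N) (enum 'I_(size l)).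

(** With D i = s i - i, the difference of the sums of squares is
    2 (sum of l_i D i) + (sum of (D i)^2). *)
Lemma sqsum_displace (l : seq nat) (s : 'S_(size l)) :
  sorted geq l -> s != 1%g -> (forall i : 'I_(size l), i <= nth 0 l i + s i)%N ->
  (sqsum l < sqsum (displace s))%N.
Proof.
move=> lS s1 ls.
rewrite -ltz_nat /sqsum /displace big_map big_enum /= (big_nth 0%N) big_mkord.
rewrite !(big_morph Posz PoszD (erefl _)) -subr_gt0 -sumrB.
set D := fun i : 'I_(size l) => (s i)%:Z - i%:Z.
have -> : \sum_(i < size l) (((nth 0 l i + s i - i) ^ 2)%N%:Z - ((nth 0 l i) ^ 2)%N%:Z) =
    2 * \sum_(i < size l) (nth 0%N l i)%:Z * D i + \sum_(i < size l) D i ^+ 2.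
  rewrite mulr_sumr -big_split; apply: eq_bigr => i _ /=.
  rewrite -!mulnn !PoszM.
  have -> : (nth 0 l i + s i - i)%N = (nth 0%N l i)%:Z + D i :> int.
    by rewrite /D; have := ls i; lia.
  ring.
have [i si] : exists i, s i != i.
  apply/existsP; apply: contraNT s1 => /existsPn sE; apply/eqP/permP => i.
  by rewrite perm1; apply/eqP; rewrite -[_ == _]negbK.
apply: ltr_wpDl; first by rewrite mulr_ge0 // rearrangement_ge0.
rewrite (bigD1 i) //= ltr_pwDl ?sumr_ge0 // => [|j _]; last exact: sqr_ge0.
by rewrite lt_def sqr_ge0 andbT sqrf_eq0 subr_eq0 eqz_nat.
Qed.

Lemma sumn_displace (l : seq nat) (s : 'S_(size l)) :
  (forall i : 'I_(size l), i <= nth 0 l i + s i)%N ->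
  sumn (displace s) = sumn l.
Proof.
move=> ls; apply/eqP; rewrite !sumnE /displace big_map big_enum /=.
rewrite -(eqn_add2r (\sum_(i < size l) (i : nat))) -big_split /=.
under eq_bigr => i _ do rewrite subnK //.
rewrite big_split /= [X in _ == (X + _)%N](big_nth 0%N) big_mkord eqn_add2l.
by rewrite -(reindex_inj (@perm_inj _ s) (P := xpredT) (F := fun i : 'I_(size l) => i : nat)).
Qed.

(** The determinant of l = to_part s is hprod l plus terms hprod (displace s'), for
    s' <> 1, with the same total degree and a larger sum of squares; as the latter
    is at most the square of the degree, the induction is on the difference. *)
Lemma hprod_span s : schur_span (sumn s) (hprod s).
Proof.
have [k] := ubnP (sumn s ^ 2 - sqsum s); elim: k s => // k IHk s.
have /andP[lS l0] := to_partP s; set l := to_part s in lS l0.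
have hl : hprod l = hprod s by exact: big_to_part hcomp0.
have nl : sumn l = sumn s by rewrite !sumnE; exact: big_to_part.
have ql : sqsum l = sqsum s by exact: big_to_part.
rewrite -hl -nl -ql ltnS => lek.
pose T (σ : 'S_(size l)) : symfun :=
  \prod_(i < size l) shifted hcomp (nth 0%N l i + σ i) i.
have detE : schur l = \sum_(σ : 'S_(size l)) (-1) ^+ σ * T σ.
  by apply: eq_bigr => σ _; congr (_ * _); apply: eq_bigr => i _; rewrite mxE.
have T1 : T 1%g = hprod l.
  rewrite /hprod (big_nth 0%N) big_mkord; apply: eq_bigr => i _.
  by rewrite perm1 /shifted leq_addl addnK.
have -> : hprod l = schur l - \sum_(σ : 'S_(size l) | σ != 1%g) (-1) ^+ σ * T σ.
  by rewrite detE (bigD1 1%g isT) odd_perm1 expr0 mul1r T1 addrK.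
rewrite -scaleN1r; apply: schur_spanD; first exact: (schur_span_schur (IntPart (to_partP s))).
apply/schur_spanZ/schur_span_sum => σ σ1.
have -> : (-1) ^+ σ * T σ = (-1) ^+ σ *: T σ.
  by case: (σ : bool); rewrite ?scaleN1r ?mulN1r ?scale1r ?mul1r.
apply: schur_spanZ.
have [/forallP ls | /forallPn[i si]] :=
    boolP [forall i : 'I_(size l), (i <= nth 0 l i + σ i)%N]; last first.
  rewrite /T (bigD1 i isT) /= /shifted (negPf si) mul0r; exact: schur_span0.
have -> : T σ = hprod (displace σ).
  by rewrite /hprod /displace big_map big_enum; apply: eq_bigr => i _; rewrite /shifted ls.
have dE := sumn_displace ls; rewrite -dE; apply: (IHk (displace σ)).
rewrite dE; have := sqsum_displace lS σ1 ls; have := sqsum_le (displace σ).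
by rewrite dE => ? ?; lia.
Qed.

(** Homogeneous polynomials of degree n in the complete functions. *)
Inductive hgraded : nat -> symfun -> Prop :=
| hgraded_hcomp n : hgraded n (hcomp n)
| hgradedD n f g : hgraded n f -> hgraded n g -> hgraded n (f + g)
| hgradedZ n k f : hgraded n f -> hgraded n (k *: f)
| hgradedM m n f g : hgraded m f -> hgraded n g -> hgraded (m + n) (f * g).

(** For an induction on the generation of f, multiplication by f must be seen as an
    operator on those g whose products with all hprod s have an expansion. *)
Lemma hgraded_span n f : hgraded n f -> schur_span n f.
Proof.
pose Q k g := forall s, schur_span (k + sumn s) (g * hprod s).
suff QM : hgraded n f -> forall k g, Q k g -> Q (n + k)%N (f * g).
  move=> /QM /(_ 0%N 1); rewrite mulr1 addn0 => Qf.
  have /Qf/(_ [::]) : Q 0%N 1 by move=> s; rewrite mul1r; exact: hprod_span.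
  by rewrite /hprod big_nil mulr1 addn0.
elim=> {n f} [n | n f1 f2 _ IH1 _ IH2 | n c f _ IH | m n f1 f2 _ IH1 _ IH2] k g Qg s.
- have := Qg (n :: s); rewrite /hprod big_cons /= mulrCA mulrA.
  by rewrite addnCA addnA.
- by rewrite mulrDl mulrDl; apply: schur_spanD; [exact: IH1 | exact: IH2].
- by rewrite -!scalerAl; apply/schur_spanZ/IH.
- have := IH1 _ _ (IH2 _ _ Qg) s; by rewrite !mulrA addnA.
Qed.

Lemma hgraded0 n : hgraded n 0.
Proof. by rewrite -(scale0r (hcomp n)); exact/hgradedZ/hgraded_hcomp. Qed.

Lemma hgraded_sum n m (F : 'I_m -> symfun) :
  (forall i, hgraded n (F i)) -> hgraded n (\sum_i F i).
Proof.
by move=> FP; elim/big_rec: _ => [|i f _]; [exact: hgraded0 | exact: hgradedD].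
Qed.

Lemma hgraded_psum n : (0 < n)%N -> hgraded n (psum n).
Proof.
elim/ltn_ind: n => -[|n] // IHn _.
have hN : n.+1%:R *: hcomp n.+1 =
    \sum_(i < n) psum i.+1 * hcomp (n.+1 - i.+1) + psum n.+1.
  rewrite hcomp_newton big_ord_recr; congr (_ + _).
  by rewrite [X in _ * X](_ : _ = 1) ?mulr1 // subnn hcomp0.
rewrite -[psum n.+1](addKr (\sum_(i < n) psum i.+1 * hcomp (n.+1 - i.+1))) -hN.
rewrite addrC -scaleN1r.
apply: hgradedD; first exact/hgradedZ/hgraded_hcomp.
apply/hgradedZ/hgraded_sum => i.
rewrite -{1}(subnKC (ltnW (ltn_ord i) : i.+1 <= n.+1)%N).
by apply: hgradedM; [exact: (IHn i.+1 (ltn_ord i) isT) | exact: hgraded_hcomp].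
Qed.

(** For v k = p_k o f with f homogeneous of degree d, this is the degree of the
    plethysm h_n o f. *)
Lemma hgraded_eval_hcomp d (v : nat -> symfun) n :
  (forall k, (0 < k)%N -> hgraded (k * d) (v k)) ->
  hgraded (n * d) (psum_eval v (hcomp n)).
Proof.
move=> vd; have [h0 hS] := newton_psum_eval v.
elim/newton_ind: n => [|n IHn]; first by rewrite h0 -hcomp0; exact: hgraded_hcomp.
have n0 : n.+1%:R != 0 :> rat by rewrite pnatr_eq0.
rewrite (canRL (scalerK n0) (hS n.+1)); apply/hgradedZ/hgraded_sum => i.
rewrite -{1}(subnKC (ltn_ord i)) mulnDl.
by apply: hgradedM; [exact: vd | apply: IHn; rewrite subSS leq_subr].
Qed.

Lemma pleth3_span a b c :
  schur_span (a * b * c)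
    (pleth (schur_row c) (pleth (schur_row b) (schur_row a))).
Proof.
rewrite !schur_row_hcomp (_ : a * b * c = c * (b * a))%N; last by lia.
apply/hgraded_span/hgraded_eval_hcomp => k k0; rewrite /adams psum_eval_pleth.
rewrite mulnCA; apply: hgraded_eval_hcomp => m m0.
rewrite (_ : m * (k * a) = a * (m * k))%N; last by lia.
apply: hgraded_eval_hcomp => j j0.
rewrite (_ : j * (m * k) = k * (m * j))%N; last by lia.
by apply: hgraded_psum; rewrite !muln_gt0 k0 m0.
Qed.

(** * The exchange of variables *)

Lemma hook_psumM (A : comAlgType rat) (x y z : A) n k :
  hook_psum x y z (n * k) = hook_psum (x ^+ n) (y ^+ n) (z ^+ n) k.
Proof. by rewrite /hook_psum !exprM. Qed.

(** The value of h_(a+2) at the n m-th powers of x, y, z is x^(n m a) times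
    (x^(n m) - y^(n m)) (x^(n m) - z^(n m)); the homogeneity of h_b and h_c brings
    the powers of x outside. *)
Lemma pleth3_eval (A : comAlgType rat) (x y z : A) a b c :
  psum_eval (hook_psum x y z)
    (pleth (schur_row c) (pleth (schur_row b) (schur_row a.+2)))
  = x ^+ (a * b * c) * psum_eval (fun n => psum_eval (fun m =>
      (x ^+ (n * m) - y ^+ (n * m)) * (x ^+ (n * m) - z ^+ (n * m)))
      (hcomp b)) (hcomp c).
Proof.
rewrite !schur_row_hcomp psum_eval_pleth exprM -hcomp_scale.
apply: eq_psum_eval => n n0.
rewrite psum_eval_pleth -exprM (_ : a * b * n = a * n * b)%N; last by rewrite mulnAC.
rewrite exprM -hcomp_scale; apply: eq_psum_eval => m m0.
rewrite -(eq_psum_eval (v := hook_psum (x ^+ (n * m)) (y ^+ (n * m)) (z ^+ (n * m)))).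
  by rewrite hook_psum_hcomp -[LHS]/(_ ^+ a * _) -!exprM; congr (_ ^+ _ * _); lia.
by move=> k k0; rewrite -hook_psumM mulnA.
Qed.

(** The products (x^k - y^k) (x^k - z^k) are the same for the triples
    (u q, q^2, 1) and (q, u q^2, u). *)
Lemma pleth3_eval_swap (A : comAlgType rat) (u q : A) a b c :
  let F := pleth (schur_row c) (pleth (schur_row b) (schur_row a.+2)) in
  psum_eval (hook_psum (u * q) (q ^+ 2) 1) F
  = u ^+ (a * b * c) * psum_eval (hook_psum q (u * q ^+ 2) u) F.
Proof.
rewrite /= !pleth3_eval exprMn -mulrA; congr (_ * (_ * _)).
apply: eq_psum_eval => n _; apply: eq_psum_eval => m _.
by rewrite expr1n !exprMn; ring.
Qed.

(** At (0, 1, 0) all the products (x^k - y^k) (x^k - z^k) vanish. *)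
Lemma pleth3_eval_sign (A : comAlgType rat) a b c : (0 < b)%N -> (0 < c)%N ->
  psum_eval (hook_psum (0 : A) 1 0)
    (pleth (schur_row c) (pleth (schur_row b) (schur_row a.+2))) = 0.
Proof.
have h0 (v : nat -> A) n : (forall k, (0 < k)%N -> v k = 0) -> (0 < n)%N ->
    psum_eval v (hcomp n) = 0.
  move=> v0 n0; rewrite (@eq_psum_eval _ _ (fun k => 0 ^+ k * v k)).
    by rewrite hcomp_scale expr0n gtn_eqF ?mul0r.
  by move=> k /v0 ->; rewrite mulr0.
move=> b0 c0; rewrite pleth3_eval h0 ?mulr0 // => n _; rewrite h0 // => m _.
by rewrite subrr mulr0.
Qed.

(** The difference between the value of s_l at (u q, q^2, 1) and u^N times its value
    at (q, u q^2, u), for l = (i+2, 2^b, 1^c), divided by what does not depend on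
    l. *)
Definition swap_term (A : comAlgType rat) (u q : A) N i b c : A :=
  (-1) ^+ c * (q ^+ (i + 2 * b) * (q ^+ (2 * c).+2 - 1)
               * (u ^+ i.+1 - u ^+ (N + 2 * b + c).+1)).

(** The factor u (q^2 - 1) clears both denominators y - z, which are q^2 - 1 and
    u (q^2 - 1). *)
Lemma hook_column_swap (A : comAlgType rat) (u q : A) N i b c :
  u * (q ^+ 2 - 1)
    * (psum_eval (hook_psum (u * q) (q ^+ 2) 1) (schur (hook_column_seq i.+2 b c))
       - u ^+ N * psum_eval (hook_psum q (u * q ^+ 2) u)
                            (schur (hook_column_seq i.+2 b c)))
  = (u * q - q ^+ 2) * (u * q - 1) * swap_term u q N i b c.
Proof.
rewrite !(psum_eval_schur _ (hook_psum_hcomp _ _ _)) /swap_term.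
have D1 := jacobi_trudi_hook_column (u * q) (q ^+ 2) 1 i b c.
have D2 := jacobi_trudi_hook_column q (u * q ^+ 2) u i b c.
set d1 := jacobi_trudi (hook_hcomp (u * q) _ _) _ in D1 *.
set d2 := jacobi_trudi (hook_hcomp q _ _) _ in D2 *.
transitivity (u * ((q ^+ 2 - 1) * d1) - u ^+ N * ((u * q ^+ 2 - u) * d2)); first by ring.
rewrite D1 D2 !exprMn !expr1n !mul2n -!addnn.
rewrite !(exprD, exprS); ring.
Qed.

(** * Shapes of partitions *)

Lemma sorted_one_column (l : seq nat) :
  path geq 1%N l -> count_mem 2 l = 0%N.
Proof.
move=> /(order_path_min geq_trans)/allP l1.
by apply/count_memPn; apply/negP => /l1.
Qed.

Lemma sorted_two_columns (l : seq nat) :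
  sorted geq l -> 0%N \notin l -> (nth 0 l 0 <= 2)%N ->
  l = nseq (count_mem 2 l) 2%N ++ nseq (count_mem 1%N l) 1%N.
Proof.
elim: l => //= a l IHl lS; rewrite inE negb_or => /andP[a0 l0] a2.
have hd : (nth 0 l 0 <= a)%N by case: l lS {IHl l0} => //= b l /andP[].
have {IHl} lE := IHl (path_sorted lS) l0 (leq_trans hd a2).
case: a a0 a2 lS hd => [|[|[|a]]] // _ _ lS hd; rewrite ?add0n ?add1n /=; last first.
  by rewrite {1}lE.
by rewrite {1}lE (sorted_one_column lS).
Qed.

Variant part_shape (l : seq nat) : Prop :=
| PartColumn of l = nseq (sumn l) 1%N
| PartHookColumn i b c of l = hook_column_seq i.+2 b c
| PartThirdColumn a b l' of l = [:: a.+2, b.+3 & l'].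

Lemma part_shapeP (l : intpart) : part_shape l.
Proof.
case: l => -[|a l] /= /andP[lS]; first by move=> _; exact: PartColumn.
rewrite inE negb_or => /andP[a0 l0].
have [l3 | l2] := ltnP 2 (nth 0 l 0).
  case: l lS l3 {l0} => [|[|[|[|b]]] l] //= /andP[ab _] _.
  by case: a ab {a0} => [|[|a]] // _; exact: PartThirdColumn.
have lE := sorted_two_columns (path_sorted lS) l0 l2.
case: a a0 lS => [|[|a]] // _ lS; last by rewrite lE; exact: PartHookColumn.
by apply: PartColumn; rewrite lE (sorted_one_column lS) /= sumn_nseq mul1n.
Qed.

Lemma hook_column_part i b c : is_intpart (hook_column_seq i.+2 b c).
Proof.
apply/andP; split; last first.
  rewrite inE mem_cat !mem_nseq /=; by rewrite !andbF.
have twos k : path geq k.+1 (nseq c 1%N) by elim: c k => //= c IHc k; exact: IHc.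
rewrite /sorted /= -[i.+2]/(i.+1.+1); elim: b i => [|b IHb] i; first exact: twos.
exact: (IHb 0%N).
Qed.

(** * Comparison of coefficients *)

Lemma psum_eval_schur_comb (A : comAlgType rat) (v : nat -> A) c :
  psum_eval v (schur_comb c) = \sum_(l <- msupp c) c@_l *: psum_eval v (schur l).
Proof.
rewrite /schur_comb mmapE rmorph_sum; apply: eq_bigr => l _ /=.
by rewrite mulr_algl psum_evalZ.
Qed.

Lemma sum_msupp_indic (R : nzRingType) (K : choiceType) (c : {malg R[K]}) (k : K) :
  \sum_(l <- msupp c) c@_l * (l == k)%:R = c@_k.
Proof.
rewrite [in RHS](monalgE c) raddf_sum /=; apply: eq_bigr => l _.
by rewrite mcoeffU; case: eqP; rewrite ?mulr1 ?mulr0.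
Qed.

(** For l = (i+2, 2^b, 1^c), the multiplicities of 2 and 1 below the first row
    are b and c; shapes with a third column evaluate to 0. *)
Definition part_swap_term (A : comAlgType rat) (u q : A) N (l : seq nat) : A :=
  if l is a.+2 :: l' then
    if (nth 0 l' 0 <= 2)%N then
      swap_term u q N a (count_mem 2 l') (count_mem 1%N l')
    else 0
  else 0.

Lemma part_swap_term_hook (A : comAlgType rat) (u q : A) N i b c :
  part_swap_term u q N (hook_column_seq i.+2 b c) = swap_term u q N i b c.
Proof.
rewrite /= !count_cat !count_nseq /= !mul0n !mul1n addn0 add0n.
by case: ifP => //; case: b => [|b] //; case: c.
Qed.

Lemma psum_eval_part_swap (A : comAlgType rat) (u q : A) N (l : intpart) :
  l <> nseq (sumn l) 1%N :> seq nat ->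
  u * (q ^+ 2 - 1)
    * (psum_eval (hook_psum (u * q) (q ^+ 2) 1) (schur l)
       - u ^+ N * psum_eval (hook_psum q (u * q ^+ 2) u) (schur l))
  = (u * q - q ^+ 2) * (u * q - 1) * part_swap_term u q N l.
Proof.
case: (part_shapeP l) => [-> | i b c -> _ | a b l' -> _].
- by rewrite sumn_nseq mul1n.
- by rewrite hook_column_swap part_swap_term_hook.
rewrite !(psum_eval_schur _ (hook_psum_hcomp _ _ _)).
by rewrite !jacobi_trudi_third_column /= !(mulr0, subr0).
Qed.

Lemma eqn_base K p p' r r' : (r < K)%N -> (r' < K)%N ->
  (r + K * p == r' + K * p')%N = (p == p') && (r == r').
Proof.
move=> rK r'K; apply/eqP/andP => [e | [/eqP-> /eqP->] //].
have K0 : (0 < K)%N by exact: leq_ltn_trans rK.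
have := congr1 (divn^~ K) e; rewrite ![(K * _)%N]mulnC !divnDMl // !divn_small // !add0n => pp.
by move: e; rewrite pp => /addIn ->.
Qed.

Lemma coef_signM (c k : nat) (p : {poly rat}) : ((-1) ^+ c * p)`_k = (-1) ^+ c * p`_k.
Proof. by rewrite -signr_odd -[in RHS]signr_odd !mulr_sign; case: odd; rewrite ?coefN. Qed.

(** Setting u = X^K and q = X with K above all exponents of q keeps distinct
    monomials in u and q distinct.  The exponents of q in swap_term are M - c and
    M + c + 2; the coefficient is taken at u^(i0+1) q^(M - c0), so the second one
    never contributes. *)
Lemma coef_swap_term M N i b c i0 b0 c0 :
  (i + 2 * b + c = M)%N -> (i0 + 2 * b0 + c0 = M)%N ->
  let K := (2 * M + 4)%N in
  (swap_term ('X^K : {poly rat}) 'X N i b c)`_(i0 + 2 * b0 + K * i0.+1)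
  = (-1) ^+ c * (((N + 2 * b + c == i0) && (c == c0))%:R
                 - ((i == i0) && (b == b0))%:R).
Proof.
move=> eM eM0 K; rewrite coef_signM; congr (_ * _).
rewrite !(mulrBl, mulrBr) mulr1 -!exprM -!exprD !coefB !coefXn.
have r0 : (i0 + 2 * b0 < K)%N by rewrite /K; lia.
have r1 : (i + 2 * b < K)%N by rewrite /K; lia.
have r2 : (i + 2 * b + (2 * c).+2 < K)%N by rewrite /K; lia.
do 4!rewrite (@eqn_base K) //.
have -> : (i0 + 2 * b0 == i + 2 * b + (2 * c).+2)%N = false by lia.
rewrite !andbF !sub0r opprK addrC; congr (_%:R - _%:R); congr nat_of_bool.
  by apply/idP/idP; lia.
by apply/idP/idP; lia.
Qed.

(** The alphabet -1 kills the plethysm and every Schur function but those of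
    columns. *)
Lemma schur_column_absent a b c e (l : intpart) : (0 < b)%N -> (0 < c)%N ->
  pleth (schur_row c) (pleth (schur_row b) (schur_row a.+2)) = schur_comb e ->
  (forall m : intpart, m \in msupp e -> sumn m = sumn l) ->
  l = nseq (sumn l) 1%N :> seq nat -> e@_l = 0.
Proof.
move=> b0 c0 eF en lE.
have := pleth3_eval_sign {poly rat} a b0 c0; rewrite eF psum_eval_schur_comb.
have -> : \sum_(m <- msupp e) e@_m *: psum_eval (hook_psum (0 : {poly rat}) 1 0) (schur m)
    = \sum_(m <- msupp e) ((-1) ^+ sumn l * (e@_m * (m == l)%:R))%:P.
  rewrite !big_seq; apply: eq_bigr => m mS.
  have not_l i s : m = i.+2 :: s :> seq nat -> (m == l) = false.
    by move=> mE; apply/eqP => ml; move: mE; rewrite ml lE /=; case: (sumn l).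
  rewrite (psum_eval_schur _ (hook_psum_hcomp _ _ _)) -mul_polyC mulrCA polyCM.
  congr (_ * _).
  have := en m mS; case: (part_shapeP m) => [mE nE | i b' c' mE _ | a' b' l' mE _].
  - rewrite (_ : m = l); last by apply: val_inj; rewrite /= lE mE nE.
    rewrite eqxx mulr1 [in LHS]lE jacobi_trudi_sign_column.
    by rewrite rmorphXn rmorphN1.
  - have := jacobi_trudi_hook_column (0 : {poly rat}) 1 0 i b' c'.
    by rewrite !subr0 mul1r !(mulr0, mul0r) (not_l _ _ mE) mulr0 mE polyC0.
  - by rewrite (not_l _ _ mE) mulr0 mE jacobi_trudi_third_column polyC0.
rewrite -rmorph_sum -mulr_sumr sum_msupp_indic => /eqP.
by rewrite polyC_eq0 mulf_eq0 signr_eq0 => /eqP.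
Qed.

(** K > 1 makes the common factor (u q - q^2) (u q - 1) nonzero at u = X^K, q = X. *)
Lemma swap_term_sum a b c e :
  pleth (schur_row c) (pleth (schur_row b) (schur_row a.+2)) = schur_comb e ->
  (forall l : intpart, l \in msupp e -> l <> nseq (sumn l) 1%N :> seq nat) ->
  forall K, (1 < K)%N ->
  \sum_(l <- msupp e) e@_l *: part_swap_term ('X^K : {poly rat}) 'X (a * b * c) l = 0.
Proof.
move=> eF ncol K K1; pose u : {poly rat} := 'X^K; rewrite -/u.
have := pleth3_eval_swap u 'X a b c; rewrite /= eF !psum_eval_schur_comb.
move/eqP; rewrite -subr_eq0 mulr_sumr -sumrB => /eqP S0.
pose D : {poly rat} := (u * 'X - 'X ^+ 2) * (u * 'X - 1).
have D0 : D != 0.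
  have top (p : {poly rat}) : p`_K.+1 = 0 -> u * 'X - p != 0.
    move=> p0; apply/eqP => /(congr1 (fun r : {poly rat} => r`_K.+1)).
    by rewrite coefB p0 coef0 subr0 -exprSr coefXn eqxx => /eqP; rewrite oner_eq0.
  by rewrite mulf_neq0 // top ?coefXn ?coef1 // eqSS gtn_eqF.
apply: (mulfI D0); rewrite mulr0 -[RHS](mulr0 (u * ('X ^+ 2 - 1))) -[X in _ = _ * X]S0.
rewrite !mulr_sumr [LHS]big_seq [RHS]big_seq; apply: eq_bigr => l lS.
rewrite -!scalerAr -scalerBr -scalerAr.
by rewrite psum_eval_part_swap //; exact: ncol.
Qed.

Lemma hook_column_seq_eq i b c i' b' c' :
  (hook_column_seq i b c == hook_column_seq i' b' c')
  = [&& i == i', b == b' & c == c'].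
Proof.
apply/eqP/and3P => [[-> e] | [/eqP-> /eqP-> /eqP->] //].
have := congr1 (count_mem 2) e; have := congr1 (count_mem 1%N) e.
by rewrite !count_cat !count_nseq /= !mul0n !mul1n !addn0 !add0n eqxx => -> ->; rewrite !eqxx.
Qed.

Lemma hook_column_second i b c : (nth 0 (hook_column_seq i b c) 1 <= 2)%N.
Proof. by case: b => [|b] //; case: c. Qed.

(** The coefficient of u^(i0+1) q^(i0+2 b0) in the vanishing sum of swap_term_sum is,
    up to sign, that of the flip of mu minus that of mu when the flip exists, and
    minus that of mu otherwise; the second case contradicts that mu is in the
    support. *)
Lemma flip_coef a b c e n :
  pleth (schur_row c) (pleth (schur_row b) (schur_row a.+2)) = schur_comb e ->
  (forall l : intpart, l \in msupp e -> sumn l = n) ->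
  (forall l : intpart, l \in msupp e -> l <> nseq (sumn l) 1%N :> seq nat) ->
  forall (mu : intpart) i0 b0 c0, mu \in msupp e ->
  mu = hook_column_seq i0.+2 b0 c0 :> seq nat ->
  exists (nu : intpart) d0, [/\ i0 = (a * b * c + 2 * d0 + c0)%N,
    nu = hook_column_seq (a * b * c + 2 * b0 + c0).+2 d0 c0 :> seq nat
    & e@_mu = e@_nu].
Proof.
set N := (a * b * c)%N => eF en ncol mu i0 b0 c0 muS muE.
pose M := (i0 + 2 * b0 + c0)%N; pose K := (2 * M + 4)%N.
have sz i j k (l : intpart) : l \in msupp e -> l = hook_column_seq i.+2 j k :> seq nat ->
    (i + 2 * j + k = M)%N.
  move=> lS lE; have := en l lS; rewrite -(en mu muS) lE muE /= !sumn_cat !sumn_nseq /M; lia.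
have K1 : (1 < K)%N by rewrite /K; lia.
have := swap_term_sum eF ncol K1; rewrite -/N.
move=> /(congr1 (fun p : {poly rat} => p`_(i0 + 2 * b0 + K * i0.+1))).
rewrite coef_sum coef0.
under eq_bigr => l _ do rewrite coefZ.
(* nu is the flip of mu exactly when ok holds. *)
pose d0 := (i0 - (N + c0))./2.
pose ok := (i0 == N + 2 * d0 + c0)%N.
pose nu := IntPart (hook_column_part (N + 2 * b0 + c0) d0 c0).
have termE (l : intpart) : l \in msupp e ->
   (part_swap_term ('X^K : {poly rat}) 'X N l)`_(i0 + 2 * b0 + K * i0.+1)
   = (-1) ^+ c0 * ((ok && (l == nu))%:R - (l == mu)%:R).
  move=> lS; rewrite -!val_eqE /= muE.
  case: (part_shapeP l) => [/(ncol l lS)// | i b' c' lE | a' b' l' lE]; last first.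
    have far j k m : (l == hook_column_seq j k m :> seq nat) = false.
      by apply/eqP => lH; have := hook_column_second j k m; rewrite -lH lE.
    by rewrite !far andbF subrr mulr0 lE /= coef0.
  have iM := sz i b' c' l lS lE.
  rewrite lE part_swap_term_hook (coef_swap_term N iM (erefl M)) !hook_column_seq_eq !eqSS.
  have -> : (N + 2 * b' + c' == i0)%N && (c' == c0)
      = ok && [&& i == (N + 2 * b0 + c0)%N, b' == d0 & c' == c0].
    by rewrite /ok /d0; apply/idP/idP; rewrite /M in iM; lia.
  have -> : (i == i0) && (b' == b0) = [&& i == i0, b' == b0 & c' == c0].
    by rewrite /M in iM; apply/idP/idP; lia.
  have [-> // | cc] := eqVneq c' c0.
  by rewrite !andbF subrr !mulr0.
rewrite big_seq; under eq_bigr => l lS do rewrite termE // mulrCA mulrBr -mulnb natrM.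
rewrite -big_seq -mulr_sumr sumrB sum_msupp_indic => /eqP.
under eq_bigr => l _ do rewrite mulrCA.
rewrite -mulr_sumr sum_msupp_indic mulf_eq0 signr_eq0 subr_eq0 => /eqP eE.
have okT : ok.
  by apply: contraTT muS => /negPf okF; rewrite -mcoeff_neq0 -eE okF mul0r eqxx.
exists nu, d0; split=> //; first by apply/eqP.
by rewrite -eE okT mul1r.
Qed.

Local Close Scope ring_scope.

Theorem mainTheorem5 (a b c : nat) (ha : 2 <= a) (hb : 2 <= b) (hc : 2 <= c)
  (hbc : b = 2 \/ c = 2) :
  flip_symmetric (a * b * c - 2 * (b * c - 1))
    (pleth (schur_row c) (pleth (schur_row b) (schur_row a))).
Proof.
case: a ha => [|[|a]] // _.
have [e eF en] := pleth3_span a.+2 b c.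
have [b0 c0] : 0 < b /\ 0 < c by lia.
have ncol (l : intpart) : l \in msupp e -> l <> nseq (sumn l) 1 :> seq nat.
  move=> lS lE; suff e0 : (e@_l = 0)%R by rewrite -mcoeff_neq0 e0 eqxx in lS.
  by apply: (schur_column_absent b0 c0 eF _ lE) => m mS; rewrite (en m mS) (en l lS).
exists e; first exact: schur_combE.
move=> mu [i [k [m muE]]] muS.
have [i0 [k0 [m0 {}muE]]] : exists i k m, mu = hook_column_seq i.+2 k m :> seq nat.
  case: (part_shapeP mu) => [/(ncol _ muS) // | i0 k0 m0 | a' b' l' lE]; first by exists i0, k0, m0.
  by have := hook_column_second i k m; rewrite -muE lE.
have [nu [d [iE nuE muN]]] := flip_coef eF en ncol muS muE.
have rE : a.+2 * b * c - 2 * (b * c - 1) = (a * b * c).+2 by nia.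
exists nu => //; split; first by rewrite rE.
by exists k0, m0, d; rewrite rE muE nuE iE.
Qed.
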